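(* Let $R$ be an associative commutative ring with identity and let $\Gamma_1,\Gamma_2$ be small categories such that there exists an equivalence of categories $F\colon\Gamma_1\to\Gamma_2$. Then $\Gamma_1$ is of type (FP$_R$) if and only if $\Gamma_2$ is of type (FP$_R$). In this case the isomorphism induced by $F$, $$F_*\colon K_0(R\Gamma_1)\xrightarrow{\cong}K_0(R\Gamma_2),$$ maps $o(\Gamma_1;R)$ to $o(\Gamma_2;R)$. Moreover, $\Gamma_1$ is of type (FF$_R$) if and only if $\Gamma_2$ is of type (FF$_R$).
   Context: For a small category $\Gamma$, an $R\Gamma$-module is a functor $\Gamma^{op}\to R\text{-Mod}$; morphisms are natural transformations and exactness is objectwise. $R\,\mathrm{mor}(?,x)$ is the $R\Gamma$-module sending $y$ to the free $R$-module on $\mathrm{mor}(y,x)$. A finitely generated (f.g.) free $R\Gamma$-module is a finite direct sum of such modules; a f.g. projective one is a direct summand of a f.g. free one. $K_0(R\Gamma)$ is the abelian group generated by isomorphism classes of f.g. projective $R\Gamma$-modules with relations $[P_0]-[P_1]+[P_2]=0$ for short exact sequences $0\to P_0\to P_1\to P_2\to0$. A finite projective (resp. finite free) resolution of $M$ is a resolution $P_*$ with finitely many nonzero terms, each f.g. projective (resp. f.g. free). $\Gamma$ is of type (FP$_R$) (resp. (FF$_R$)) if the constant $R\Gamma$-module $\underline{R}$ with value $R$ has a finite projective (resp. finite free) resolution. If $\Gamma$ is of type (FP$_R$), its finiteness obstruction is $o(\Gamma;R):=\sum_n(-1)^n[P_n]\in K_0(R\Gamma)$ for any finite projective resolution $P_*$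 of $\underline{R}$. $F_*$ is induced by the induction functor $\mathrm{ind}_F$ sending an $R\Gamma_1$-module $M$ to $M(?)\otimes_{R\Gamma_1}R\,\mathrm{mor}_{\Gamma_2}(??,F(?))$, where the tensor product $M\otimes_{R\Gamma}N$ of a contravariant module $M$ and a covariant module $N$ is the quotient of $\bigoplus_xM(x)\otimes_RN(x)$ by the relations $M(f)m\otimes n=m\otimes N(f)n$ for morphisms $f\colon x\to y$, $m\in M(y)$, $n\in N(x)$. *)

(* Defs.v *)
From HB Require Import structures.
From mathcomp Require Import all_boot all_order all_algebra.
From mathcomp Require Import boolp.

Set Implicit Arguments.
Unset Strict Implicit.
Unset Printing Implicit Defensive.

Import GRing.Theory.
Local Open Scope ring_scope.
Local Open Scope quotient_scope.

Record smallCat : Type := SmallCat {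
  cat_ob :> Type;
  mor : cat_ob -> cat_ob -> Type;
  idm : forall x, mor x x;
  ccomp : forall x y z, mor y z -> mor x y -> mor x z;
  ccomp1m : forall x y (f : mor x y), ccomp (idm y) f = f;
  ccompm1 : forall x y (f : mor x y), ccomp f (idm x) = f;
  ccompA : forall x y z t (h : mor z t) (g : mor y z) (f : mor x y),
    ccomp h (ccomp g f) = ccomp (ccomp h g) f }.

Arguments idm {s} x.
Arguments ccomp {s x y z} g f.

Notation "g \c f" := (ccomp g f) (at level 50, left associativity).

Definition opCat (G : smallCat) : smallCat :=
  @SmallCat G (fun x y => @mor G y x) (fun x => idm x)
    (fun x y z g f => f \c g)
    (fun x y f => ccompm1 f) (fun x y f => ccomp1m f)
    (fun x y z t h g f => esym (ccompA f g h)).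

Record catFun (G1 G2 : smallCat) : Type := CatFun {
  fun_ob :> G1 -> G2;
  fun_mor : forall x y, mor x y -> mor (fun_ob x) (fun_ob y);
  fun_mor1 : forall x, fun_mor (idm x) = idm (fun_ob x);
  fun_morM : forall x y z (g : mor y z) (f : mor x y),
    fun_mor (g \c f) = fun_mor g \c fun_mor f }.

Definition idFun (G : smallCat) : catFun G G :=
  @CatFun G G id (fun x y f => f) (fun x => erefl) (fun x y z g f => erefl).

Lemma compFun_mor1 (G1 G2 G3 : smallCat) (E : catFun G2 G3) (F : catFun G1 G2) x :
  fun_mor E (fun_mor F (idm x)) = idm (E (F x)).
Proof. by rewrite !fun_mor1. Qed.

Lemma compFun_morM (G1 G2 G3 : smallCat) (E : catFun G2 G3) (F : catFun G1 G2)
    (x y z : G1) (g : mor y z) (f : mor x y) :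
  fun_mor E (fun_mor F (g \c f)) =
  fun_mor E (fun_mor F g) \c fun_mor E (fun_mor F f).
Proof. by rewrite !fun_morM. Qed.

Definition compFun (G1 G2 G3 : smallCat) (E : catFun G2 G3) (F : catFun G1 G2) :
    catFun G1 G3 :=
  @CatFun G1 G3 (fun x => E (F x)) (fun x y f => fun_mor E (fun_mor F f))
    (compFun_mor1 E F) (@compFun_morM _ _ _ E F).

Definition cat_iso (G : smallCat) (x y : G) (f : mor x y) : Prop :=
  exists g : mor y x, g \c f = idm x /\ f \c g = idm y.

Definition nat_iso (G1 G2 : smallCat) (F E : catFun G1 G2) : Prop :=
  exists t : forall x, mor (F x) (E x),
    (forall x y (f : mor x y), t y \c fun_mor F f = fun_mor E f \c t x) /\
    (forall x, cat_iso (t x)).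

Definition is_equivalence (G1 G2 : smallCat) (F : catFun G1 G2) : Prop :=
  exists E : catFun G2 G1,
    nat_iso (compFun E F) (idFun G1) /\ nat_iso (compFun F E) (idFun G2).

Inductive pterm (R S : Type) : Type :=
| PZero
| PGen of S
| PAdd of pterm R S & pterm R S
| PScale of R & pterm R S.

Arguments PZero {R S}.
Arguments PGen {R S} s.
Arguments PAdd {R S} a b.
Arguments PScale {R S} r a.

(* The smallest R-module congruence containing [rel]; the negative of a term
   is its multiple by -1. *)
Inductive peq (R : pzRingType) (S : Type) (rel : pterm R S -> pterm R S -> Prop) :
  pterm R S -> pterm R S -> Prop :=
| peq_rel a b of rel a b : peq rel a b
| peq_refl a : peq rel a a
| peq_sym a b of peq rel a b : peq rel b a
| peq_trans a b c of peq rel a b & peq rel b c : peq rel a c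
| peq_add a a' b b' of peq rel a a' & peq rel b b' :
    peq rel (PAdd a b) (PAdd a' b')
| peq_scale r a a' of peq rel a a' : peq rel (PScale r a) (PScale r a')
| peq_addA a b c : peq rel (PAdd a (PAdd b c)) (PAdd (PAdd a b) c)
| peq_addC a b : peq rel (PAdd a b) (PAdd b a)
| peq_add0 a : peq rel (PAdd PZero a) a
| peq_addN a : peq rel (PAdd (PScale (-1) a) a) PZero
| peq_scaleA r s a : peq rel (PScale r (PScale s a)) (PScale (r * s) a)
| peq_scale1 a : peq rel (PScale 1 a) a
| peq_scaleDr r a b :
    peq rel (PScale r (PAdd a b)) (PAdd (PScale r a) (PScale r b))
| peq_scaleDl r s a :
    peq rel (PScale (r + s) a) (PAdd (PScale r a) (PScale s a)).

Section Presented.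
Variables (R : pzRingType) (S : Type) (rel : pterm R S -> pterm R S -> Prop).

Definition peqb (a b : {classic pterm R S}) : bool := `[< peq rel a b >].

Lemma peqb_refl : reflexive peqb.
Proof. by move=> a; apply/asboolP; exact: peq_refl. Qed.

Lemma peqb_sym : symmetric peqb.
Proof. by move=> a b; apply/asboolP/asboolP; exact: peq_sym. Qed.

Lemma peqb_trans : transitive peqb.
Proof.
by move=> b a c /asboolP ab /asboolP bc; apply/asboolP; exact: peq_trans bc.
Qed.

Canonical peqb_equiv := EquivRel peqb peqb_refl peqb_sym peqb_trans.

Definition presented : Type := {eq_quot peqb_equiv}.
HB.instance Definition _ := Choice.on presented.

Definition pclass (a : pterm R S) : presented := \pi_({eq_quot peqb_equiv}) a.
Definition prepr (q : presented) : pterm R S := repr (q : {eq_quot peqb_equiv}).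

Lemma preprK q : pclass (prepr q) = q.
Proof. exact: reprK. Qed.

Lemma pclassP a b : pclass a = pclass b <-> peq rel a b.
Proof.
split; first by move=> /eqmodP /asboolP.
by move=> ab; apply/eqmodP/asboolP.
Qed.

Lemma prepr_class a : peq rel (prepr (pclass a)) a.
Proof. by apply/pclassP; rewrite preprK. Qed.

Definition pzero : presented := pclass PZero.
Definition padd (p q : presented) : presented := pclass (PAdd (prepr p) (prepr q)).
Definition pscale (r : R) (p : presented) : presented :=
  pclass (PScale r (prepr p)).
Definition popp (p : presented) : presented := pscale (-1) p.

Lemma padd_class a b : padd (pclass a) (pclass b) = pclass (PAdd a b).
Proof. by apply/pclassP; apply: peq_add; exact: prepr_class. Qed.

Lemma pscale_class r a : pscale r (pclass a) = pclass (PScale r a).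
Proof. by apply/pclassP; apply: peq_scale; exact: prepr_class. Qed.

Lemma paddA : associative padd.
Proof.
move=> p q s; rewrite -(preprK p) -(preprK q) -(preprK s) !padd_class.
by apply/pclassP; exact: peq_addA.
Qed.

Lemma paddC : commutative padd.
Proof. by move=> p q; apply/pclassP; exact: peq_addC. Qed.

Lemma padd0 : left_id pzero padd.
Proof.
by move=> p; rewrite -(preprK p) padd_class; apply/pclassP; exact: peq_add0.
Qed.

Lemma paddN : left_inverse pzero popp padd.
Proof.
move=> p; rewrite /popp -(preprK p) pscale_class padd_class.
by apply/pclassP; exact: peq_addN.
Qed.

HB.instance Definition _ := GRing.isZmodule.Build presented paddA paddC padd0 paddN.

Lemma pscaleA r s p : pscale r (pscale s p) = pscale (r * s) p.
Proof.
by rewrite -(preprK p) !pscale_class; apply/pclassP; exact: peq_scaleA.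
Qed.

Lemma pscale1 : left_id 1 pscale.
Proof.
by move=> p; rewrite -(preprK p) pscale_class; apply/pclassP; exact: peq_scale1.
Qed.

Lemma pscaleDr : right_distributive pscale padd.
Proof.
move=> r p q; rewrite -(preprK p) -(preprK q) !(pscale_class, padd_class).
by apply/pclassP; exact: peq_scaleDr.
Qed.

Lemma pscaleDl p : {morph pscale^~ p : r s / r + s >-> padd r s}.
Proof.
move=> r s; rewrite -(preprK p) !(pscale_class, padd_class).
by apply/pclassP; exact: peq_scaleDl.
Qed.

HB.instance Definition _ := GRing.Zmodule_isLmodule.Build R presented
  pscaleA pscale1 pscaleDr pscaleDl.

Definition pgen (s : S) : presented := pclass (PGen s).

Lemma pclassD a b : pclass (PAdd a b) = pclass a + pclass b.
Proof. by rewrite -padd_class. Qed.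

Lemma pclassZ r a : pclass (PScale r a) = r *: pclass a.
Proof. by rewrite -pscale_class. Qed.

Lemma presented_ind (P : presented -> Prop) :
  P 0 -> (forall s, P (pgen s)) -> (forall p q, P p -> P q -> P (p + q)) ->
  (forall r p, P p -> P (r *: p)) -> forall p, P p.
Proof.
move=> P0 PG PD PZ p; rewrite -(preprK p).
elim: (prepr p) => [|s|a IHa b IHb|r a IHa]; first exact: P0.
- exact: PG.
- by rewrite pclassD; exact: PD.
- by rewrite pclassZ; exact: PZ.
Qed.

Section Lift.
Variables (V : lmodType R) (phi : S -> V).

Fixpoint peval (a : pterm R S) : V :=
  match a with
  | PZero => 0
  | PGen s => phi s
  | PAdd a b => peval a + peval b
  | PScale r a => r *: peval a
  end.

Hypothesis phi_rel : forall a b, rel a b -> peval a = peval b.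

Lemma peval_eq a b : peq rel a b -> peval a = peval b.
Proof.
elim=> //=.
- by move=> ? ? ? _ -> _ ->.
- by move=> ? ? ? ? _ -> _ ->.
- by move=> ? ? ? _ ->.
- by move=> *; rewrite addrA.
- by move=> *; rewrite addrC.
- by move=> *; rewrite add0r.
- by move=> *; rewrite scaleN1r addNr.
- by move=> *; rewrite scalerA.
- by move=> *; rewrite scale1r.
- by move=> *; rewrite scalerDr.
- by move=> *; rewrite scalerDl.
Qed.

Definition plift (p : presented) : V := peval (prepr p).

Lemma plift_class a : plift (pclass a) = peval a.
Proof. by apply: peval_eq; exact: prepr_class. Qed.

Lemma plift_gen s : plift (pgen s) = phi s.
Proof. by rewrite plift_class. Qed.

Lemma plift_is_linear : linear plift.
Proof.
move=> r p q.
by rewrite -(preprK p) -(preprK q) -pclassZ -pclassD !plift_class.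
Qed.

Definition lin_lift : {linear presented -> V} :=
  HB.pack plift (GRing.isLinear.Build R presented V _ plift plift_is_linear).

End Lift.
End Presented.

Arguments pgen {R S} rel s.

Section FreeModule.
Variable R : pzRingType.

Definition no_rel (S : Type) (a b : pterm R S) : Prop := False.

Definition freeR (S : Type) : lmodType R := presented (@no_rel S).
Definition fgen (S : Type) (s : S) : freeR S := pgen (@no_rel S) s.

Lemma no_rel_lift (S : Type) (V : lmodType R) (phi : S -> V) a b :
  no_rel a b -> peval phi a = peval phi b.
Proof. by []. Qed.

Definition free_map (S T : Type) (h : S -> T) : {linear freeR S -> freeR T} :=
  lin_lift (@no_rel_lift S (freeR T) (fun s => fgen (h s))).

Lemma free_map_gen (S T : Type) (h : S -> T) s :
  free_map h (fgen s) = fgen (h s).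
Proof. exact: plift_gen. Qed.

Lemma free_map_id (S : Type) (h : S -> S) :
  (forall s, h s = s) -> forall p, free_map h p = p.
Proof.
move=> hE; apply: presented_ind => [|s|p q IHp IHq|r p IHp].
- by rewrite linear0.
- by rewrite free_map_gen hE.
- by rewrite linearD IHp IHq.
- by rewrite linearZ IHp.
Qed.

Lemma free_map_comp (S T U : Type) (g : T -> U) (f : S -> T) (h : S -> U) :
  (forall s, h s = g (f s)) ->
  forall p, free_map h p = free_map g (free_map f p).
Proof.
move=> hE; apply: presented_ind => [|s|p q IHp IHq|r p IHp].
- by rewrite !linear0.
- by rewrite !free_map_gen hE.
- by rewrite !linearD IHp IHq.
- by rewrite !linearZ IHp.
Qed.

End FreeModule.

(* A (contravariant) RG-module; a covariant one is an RG^op-module. *)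
Record catMod (R : pzRingType) (G : smallCat) : Type := CatMod {
  mod_ob :> G -> lmodType R;
  mod_mor : forall x y, mor x y -> {linear mod_ob y -> mod_ob x};
  mod_mor1 : forall x m, mod_mor (idm x) m = m;
  mod_morM : forall x y z (g : mor y z) (f : mor x y) m,
    mod_mor (g \c f) m = mod_mor f (mod_mor g m) }.

Definition covMod (R : pzRingType) (G : smallCat) : Type := catMod R (opCat G).

Section CatModules.
Variables (R : pzRingType) (G : smallCat).
Implicit Types M P Q : catMod R G.

Record modHom (M N : catMod R G) : Type := ModHom {
  hom_at :> forall x, {linear M x -> N x};
  hom_nat : forall x y (f : mor x y) m,
    hom_at x (mod_mor M f m) = mod_mor N f (hom_at y m) }.

Definition mod_iso (M N : catMod R G) : Prop :=
  exists (f : modHom M N) (g : modHom N M),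
    (forall x m, g x (f x m) = m) /\ (forall x n, f x (g x n) = n).

Definition mod_inj (M N : catMod R G) (f : modHom M N) : Prop := forall x, injective (f x).

Definition mod_surj (M N : catMod R G) (f : modHom M N) : Prop :=
  forall x n, exists m, f x m = n.

Definition exact_at (M N P : catMod R G) (f : modHom M N) (g : modHom N P) : Prop :=
  forall x n, g x n = 0 <-> exists m, f x m = n.

Definition short_exact P0 P1 P2 : Prop :=
  exists (f : modHom P0 P1) (g : modHom P1 P2),
    [/\ mod_inj f, exact_at f g & mod_surj g].

Definition zero_mod : catMod R G :=
  @CatMod R G (fun=> 'rV[R]_0) (fun x y _ => idfun)
    (fun x m => erefl) (fun x y z g f m => erefl).

Definition is_zero_mod M : Prop := forall x (m : M x), m = 0.

Section DirectSum.
Variables M N : catMod R G.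

Definition dsum_fun x y (f : mor x y) (p : (M y * N y)%type) : (M x * N x)%type :=
  (mod_mor M f p.1, mod_mor N f p.2).

Lemma dsum_fun_linear x y (f : mor x y) : linear (dsum_fun f).
Proof. by move=> r p q; rewrite /dsum_fun /= !linearP. Qed.

Definition dsum_mor x y (f : mor x y) :
    {linear (M y * N y)%type -> (M x * N x)%type} :=
  HB.pack (dsum_fun f) (GRing.isLinear.Build R _ _ _ _ (dsum_fun_linear f)).

Lemma dsum_mor1 x m : dsum_mor (idm x) m = m.
Proof. by case: m => a b; rewrite /= /dsum_fun /= !mod_mor1. Qed.

Lemma dsum_morM x y z (g : mor y z) (f : mor x y) m :
  dsum_mor (g \c f) m = dsum_mor f (dsum_mor g m).
Proof. by case: m => a b; rewrite /= /dsum_fun /= !mod_morM. Qed.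

Definition dsum : catMod R G :=
  @CatMod R G (fun x => (M x * N x)%type) dsum_mor dsum_mor1 dsum_morM.

End DirectSum.

Section Representable.
Variable x : G.

Definition rep_mor y z (f : mor y z) :
    {linear freeR R (mor z x) -> freeR R (mor y x)} :=
  free_map R (fun h : mor z x => h \c f).

Lemma rep_mor1 y m : rep_mor (idm y) m = m.
Proof. by apply: free_map_id => h; exact: ccompm1. Qed.

Lemma rep_morM y z t (g : mor z t) (f : mor y z) m :
  rep_mor (g \c f) m = rep_mor f (rep_mor g m).
Proof. by apply: free_map_comp => h; exact: ccompA. Qed.

(* R mor(?, x) *)
Definition rep_mod : catMod R G :=
  @CatMod R G (fun y => freeR R (mor y x)) rep_mor rep_mor1 rep_morM.

End Representable.

(* R mor(?, x_1) (+) ... (+) R mor(?, x_n) *)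
Fixpoint free_mod (s : seq G) : catMod R G :=
  if s is x :: s' then dsum (rep_mod x) (free_mod s') else zero_mod.

Definition fg_free M : Prop := exists s : seq G, mod_iso M (free_mod s).

Definition fg_proj P : Prop := exists Q L, fg_free L /\ mod_iso (dsum P Q) L.

Definition const_mod : catMod R G :=
  @CatMod R G (fun=> R^o) (fun x y _ => idfun)
    (fun x m => erefl) (fun x y z g f m => erefl).

(* ... -> P_2 -> P_1 -> P_0 -> M -> 0 *)
Record resolution M : Type := Resolution {
  res_ob :> nat -> catMod R G;
  res_d : forall n, modHom (res_ob n.+1) (res_ob n);
  res_aug : modHom (res_ob 0%N) M;
  res_exact : forall n, exact_at (res_d n.+1) (res_d n);
  res_exact0 : exact_at (res_d 0%N) res_aug;
  res_surj : mod_surj res_aug }.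

Definition vanishes_from M (P : resolution M) (N : nat) : Prop :=
  forall n, (N <= n)%N -> is_zero_mod (P n).

Definition finite_proj_resolution M (P : resolution M) : Prop :=
  (exists N, vanishes_from P N) /\ (forall n, fg_proj (P n)).

Definition finite_free_resolution M (P : resolution M) : Prop :=
  (exists N, vanishes_from P N) /\ (forall n, fg_free (P n)).

End CatModules.

Definition type_FP (R : pzRingType) (G : smallCat) : Prop :=
  exists P : resolution (const_mod R G), finite_proj_resolution P.

Definition type_FF (R : pzRingType) (G : smallCat) : Prop :=
  exists P : resolution (const_mod R G), finite_free_resolution P.

(* K_0(RG) is built by hand, not as a [zmodType]: its elements are made from
   modules, and so live in a larger universe than the carriers of [zmodType]s. *)
Section K0.
Variables (R : pzRingType) (G : smallCat).

Record fgProj : Type := FgProj {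
  fgp_mod :> catMod R G;
  fgpP : fg_proj fgp_mod }.

Inductive K0term : Type :=
| K0Tzero
| K0Tgen of fgProj
| K0Tadd of K0term & K0term
| K0Topp of K0term.

Inductive K0rel : K0term -> K0term -> Prop :=
| K0rel_iso (P Q : fgProj) of mod_iso P Q : K0rel (K0Tgen P) (K0Tgen Q)
| K0rel_ses (P0 P1 P2 : fgProj) of short_exact P0 P1 P2 :
    K0rel (K0Tadd (K0Tadd (K0Tgen P0) (K0Topp (K0Tgen P1))) (K0Tgen P2)) K0Tzero
| K0rel_refl a : K0rel a a
| K0rel_sym a b of K0rel a b : K0rel b a
| K0rel_trans a b c of K0rel a b & K0rel b c : K0rel a c
| K0rel_add a a' b b' of K0rel a a' & K0rel b b' :
    K0rel (K0Tadd a b) (K0Tadd a' b')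
| K0rel_opp a a' of K0rel a a' : K0rel (K0Topp a) (K0Topp a')
| K0rel_addA a b c : K0rel (K0Tadd a (K0Tadd b c)) (K0Tadd (K0Tadd a b) c)
| K0rel_addC a b : K0rel (K0Tadd a b) (K0Tadd b a)
| K0rel_add0 a : K0rel (K0Tadd K0Tzero a) a
| K0rel_addN a : K0rel (K0Tadd (K0Topp a) a) K0Tzero.

Definition K0 : Type := {A : K0term -> Prop | exists a, A = K0rel a}.

Definition K0class (a : K0term) : K0 := exist _ (K0rel a) (ex_intro _ a erefl).

Definition K0repr (u : K0) : K0term := projT1 (cid (proj2_sig u)).

Lemma K0reprK u : K0class (K0repr u) = u.
Proof.
apply: eq_sig_hprop => /= [x p q|]; first exact: Prop_irrelevance.
by rewrite /K0repr; case: (cid (proj2_sig u)) => a /= ->.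
Qed.

Lemma K0classP a b : K0class a = K0class b <-> K0rel a b.
Proof.
split=> [/(congr1 (@proj1_sig _ _)) /= ->|ab]; first exact: K0rel_refl.
apply: eq_exist => /=; apply/funext => c; apply/propext; split.
  by apply: K0rel_trans; exact: K0rel_sym.
exact: K0rel_trans.
Qed.

Lemma K0repr_class a : K0rel (K0repr (K0class a)) a.
Proof. by apply/K0classP; rewrite K0reprK. Qed.

Definition K0zero : K0 := K0class K0Tzero.
Definition K0gen (P : fgProj) : K0 := K0class (K0Tgen P).
Definition K0add (u v : K0) : K0 := K0class (K0Tadd (K0repr u) (K0repr v)).
Definition K0opp (u : K0) : K0 := K0class (K0Topp (K0repr u)).

Lemma K0add_class a b : K0add (K0class a) (K0class b) = K0class (K0Tadd a b).
Proof. by apply/K0classP; apply: K0rel_add; exact: K0repr_class. Qed.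

Lemma K0opp_class a : K0opp (K0class a) = K0class (K0Topp a).
Proof. by apply/K0classP; apply: K0rel_opp; exact: K0repr_class. Qed.

Lemma K0addA : associative K0add.
Proof.
move=> u v w; rewrite -(K0reprK u) -(K0reprK v) -(K0reprK w) !K0add_class.
by apply/K0classP; exact: K0rel_addA.
Qed.

Lemma K0addC : commutative K0add.
Proof. by move=> u v; apply/K0classP; exact: K0rel_addC. Qed.

Lemma K0add0 : left_id K0zero K0add.
Proof.
by move=> u; rewrite -(K0reprK u) K0add_class; apply/K0classP; exact: K0rel_add0.
Qed.

Lemma K0addN : left_inverse K0zero K0opp K0add.
Proof.
move=> u; rewrite -(K0reprK u) K0opp_class K0add_class.
by apply/K0classP; exact: K0rel_addN.
Qed.

(* \sum_(n < N) (-1)^n [P_n] *)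
Definition K0altsum (P : nat -> fgProj) (N : nat) : K0 :=
  iteri N (fun n u => K0add u (if odd n then K0opp (K0gen (P n)) else K0gen (P n)))
    K0zero.

(* [o] is the finiteness obstruction of G: the alternating sum of the classes of
   the terms of a finite projective resolution of the constant module. *)
Definition is_finiteness_obstruction (o : K0) : Prop :=
  exists (P : resolution (const_mod R G)) (N : nat)
         (Pproj : forall n, fg_proj (P n)),
    vanishes_from P N /\ o = K0altsum (fun n => FgProj (Pproj n)) N.

End K0.

Section Tensor.
Variables (R : comPzRingType) (G : smallCat) (M : catMod R G) (N : covMod R G).

(* The symbol m (x) n, for m in M(x) and n in N(x). *)
Record tensor_symbol : Type := TensorSymbol {
  ts_ob : G;
  ts_left : M ts_ob;
  ts_right : N ts_ob }.

Let sym x (m : M x) (n : N x) : pterm R tensor_symbol := PGen (TensorSymbol m n).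

(* The first four relations present the direct sum over x of the R-modules
   M(x) (x)_R N(x). *)
Inductive tensor_rel : pterm R tensor_symbol -> pterm R tensor_symbol -> Prop :=
| tensor_addl x (m m' : M x) (n : N x) :
    tensor_rel (sym (m + m') n) (PAdd (sym m n) (sym m' n))
| tensor_addr x (m : M x) (n n' : N x) :
    tensor_rel (sym m (n + n')) (PAdd (sym m n) (sym m n'))
| tensor_scalel r x (m : M x) (n : N x) :
    tensor_rel (sym (r *: m) n) (PScale r (sym m n))
| tensor_scaler r x (m : M x) (n : N x) :
    tensor_rel (sym m (r *: n)) (PScale r (sym m n))
| tensor_mor x y (f : @mor G x y) (m : M y) (n : N x) :
    tensor_rel (sym (mod_mor M f m) n)
               (sym m (@mod_mor R (opCat G) N y x f n)).

Definition tensor : lmodType R := presented tensor_rel.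

Definition tens x (m : M x) (n : N x) : tensor :=
  pgen tensor_rel (TensorSymbol m n).

Lemma tensDl x (m m' : M x) (n : N x) : tens (m + m') n = tens m n + tens m' n.
Proof.
by rewrite -[RHS]pclassD; apply/pclassP/peq_rel; exact: tensor_addl.
Qed.

Lemma tensDr x (m : M x) (n n' : N x) : tens m (n + n') = tens m n + tens m n'.
Proof.
by rewrite -[RHS]pclassD; apply/pclassP/peq_rel; exact: tensor_addr.
Qed.

Lemma tensZl r x (m : M x) (n : N x) : tens (r *: m) n = r *: tens m n.
Proof.
by rewrite -[RHS]pclassZ; apply/pclassP/peq_rel; exact: tensor_scalel.
Qed.

Lemma tensZr r x (m : M x) (n : N x) : tens m (r *: n) = r *: tens m n.
Proof.
by rewrite -[RHS]pclassZ; apply/pclassP/peq_rel; exact: tensor_scaler.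
Qed.

Lemma tens_mor x y (f : @mor G x y) (m : M y) (n : N x) :
  tens (mod_mor M f m) n = tens m (@mod_mor R (opCat G) N y x f n).
Proof. by apply/pclassP/peq_rel; exact: tensor_mor. Qed.

End Tensor.

Section TensorMap.
Variables (R : comPzRingType) (G : smallCat) (M : catMod R G).
Variables (N N' : covMod R G) (h : modHom N N').

Definition tensor_map_symbol (s : tensor_symbol M N) : tensor M N' :=
  tens (ts_left s) (h (ts_ob s) (ts_right s)).

Lemma tensor_map_rel a b : tensor_rel a b ->
  peval tensor_map_symbol a = peval tensor_map_symbol b.
Proof.
case=> *; rewrite /= /tensor_map_symbol /=.
- exact: tensDl.
- by rewrite linearD tensDr.
- exact: tensZl.
- by rewrite linearZ tensZr.
- by rewrite tens_mor hom_nat.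
Qed.

Definition tensor_map : {linear tensor M N -> tensor M N'} :=
  lin_lift tensor_map_rel.

Lemma tensor_map_tens x (m : M x) (n : N x) :
  tensor_map (tens m n) = tens m (h x n).
Proof. exact: (plift_gen tensor_map_rel). Qed.

End TensorMap.

Section Induction.
Variables (R : comPzRingType) (G1 G2 : smallCat) (F : catFun G1 G2).

Section CovRep.
Variable z : G2.

Definition covrep_mor (x y : opCat G1) (f : @mor (opCat G1) x y) :
    {linear freeR R (mor z (F y)) -> freeR R (mor z (F x))} :=
  free_map R (fun h : mor z (F y) => fun_mor F (f : @mor G1 y x) \c h).

Lemma covrep_mor1 x m : covrep_mor (idm x) m = m.
Proof. by apply: free_map_id => h; rewrite /= fun_mor1 ccomp1m. Qed.

Lemma covrep_morM x y t (g : @mor (opCat G1) y t) (f : @mor (opCat G1) x y) m :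
  covrep_mor (g \c f) m = covrep_mor f (covrep_mor g m).
Proof. by apply: free_map_comp => h; rewrite /= fun_morM ccompA. Qed.

(* R mor(z, F(?)) *)
Definition covrep : covMod R G1 :=
  @CatMod R (opCat G1) (fun x => freeR R (mor z (F x)))
    covrep_mor covrep_mor1 covrep_morM.

End CovRep.

Section Precomp.
Variables (w z : G2) (g : mor w z).

Definition covrep_at (x : opCat G1) : {linear covrep z x -> covrep w x} :=
  free_map R (fun h : mor z (F x) => h \c g).

Lemma covrep_nat (x y : opCat G1) (f : mor x y) (m : covrep z y) :
  covrep_at x (mod_mor (covrep z) f m) = mod_mor (covrep w) f (covrep_at y m).
Proof.
transitivity (free_map R (fun h : mor z (F y) =>
    fun_mor F (f : @mor G1 y x) \c h \c g) m).
  by symmetry; apply: free_map_comp.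
by apply: free_map_comp => h; rewrite ccompA.
Qed.

Definition covrep_precomp : modHom (covrep z) (covrep w) := ModHom covrep_nat.

End Precomp.

Section IndMod.
Variable M : catMod R G1.

Definition ind_mor (w z : G2) (g : mor w z) :
    {linear tensor M (covrep z) -> tensor M (covrep w)} :=
  tensor_map M (covrep_precomp g).

Lemma ind_mor1 z p : ind_mor (idm z) p = p.
Proof.
elim/presented_ind: p => [|[x m n]|p q IHp IHq|r p IHp].
- by rewrite linear0.
- rewrite [LHS]tensor_map_tens; congr (tens _ _).
  by apply: free_map_id => h; exact: ccompm1.
- by rewrite linearD IHp IHq.
- by rewrite linearZ IHp.
Qed.

Lemma ind_morM v w z (g : mor w z) (f : mor v w) p :
  ind_mor (g \c f) p = ind_mor f (ind_mor g p).
Proof.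
elim/presented_ind: p => [|[x m n]|p q IHp IHq|r p IHp].
- by rewrite !linear0.
- rewrite [LHS]tensor_map_tens [ind_mor g _]tensor_map_tens.
  rewrite [RHS]tensor_map_tens; congr (tens _ _).
  by apply: free_map_comp => h; exact: ccompA.
- by rewrite !linearD IHp IHq.
- by rewrite !linearZ IHp.
Qed.

(* M(?) (x)_{RG1} R mor_{G2}(??, F(?)) *)
Definition ind_mod : catMod R G2 :=
  @CatMod R G2 (fun z => tensor M (covrep z)) ind_mor ind_mor1 ind_morM.

End IndMod.

(* [phi] is the homomorphism F_* induced by induction along F; by
   [K0_induced_unique] there is at most one. *)
Definition K0_induced (phi : K0 R G1 -> K0 R G2) : Prop :=
  (forall u v, phi (K0add u v) = K0add (phi u) (phi v)) /\
  (forall P : fgProj R G1, exists indP : fg_proj (ind_mod P),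
     phi (K0gen P) = K0gen (FgProj indP)).

Lemma K0_induced_unique phi psi :
  K0_induced phi -> K0_induced psi -> phi =1 psi.
Proof.
move=> [phiD phi_gen] [psiD psi_gen].
have add0 (f : K0 R G1 -> K0 R G2) : (forall u v, f (K0add u v) = K0add (f u) (f v)) ->
    f (K0zero R G1) = K0zero R G2.
  move=> fD; set w := f _; have : K0add w w = w by rewrite -fD K0add0.
  by move=> /(congr1 (K0add (K0opp w))); rewrite K0addA K0addN K0add0.
have addN (f : K0 R G1 -> K0 R G2) v : (forall u v, f (K0add u v) = K0add (f u) (f v)) ->
    f (K0opp v) = K0opp (f v).
  move=> fD; rewrite -[LHS]K0add0 -(K0addN (f v)) -K0addA -fD.
  by rewrite [K0add v _]K0addC K0addN (add0 _ fD) K0addC K0add0.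
move=> u; rewrite -(K0reprK u).
elim: (K0repr u) => [|P|a IHa b IHb|a IHa].
- by rewrite [LHS](add0 _ phiD) [RHS](add0 _ psiD).
- have [h1 e1] := phi_gen P; have [h2 e2] := psi_gen P.
  by rewrite [LHS]e1 [RHS]e2 (Prop_irrelevance h1 h2).
- by rewrite -K0add_class phiD psiD IHa IHb.
- by rewrite -K0opp_class (addN _ _ phiD) (addN _ _ psiD) IHa.
Qed.

End Induction.

(* Main.v *)
Require Import Defs.
From HB Require Import structures.
From mathcomp Require Import all_boot all_order all_algebra.
From mathcomp Require Import boolp.

Set Implicit Arguments.
Unset Strict Implicit.
Unset Printing Implicit Defensive.

Import GRing.Theory.
Local Open Scope ring_scope.

(** Induction along an equivalence is restriction along a quasi-inverse. If
    [E : G2 -> G1] is quasi-inverse to [F], then [mor (E z) x] and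
    [mor z (F x)] are in natural bijection ([equivalence_adjunction]), so the
    co-Yoneda lemma identifies [M(?) (x) R mor(z, F(?))] with [M (E z)]
    ([ind_res_iso]). Everything then follows from properties of the functor
    [M |-> M o E].

    Restriction is exact, preserves the constant module, and carries
    [R mor(?, x)] to [R mor(E ?, x)], that is to [R mor(?, F x)] ([res_rep]).
    Hence it preserves finitely generated free and projective modules, and maps
    finite free or projective resolutions of the constant module to such
    resolutions. As the situation is symmetric in [E] and [F], this gives both
    equivalences of finiteness types. It also gives a homomorphism
    [K_0(R G1) -> K_0(R G2)] whose inverse is restriction along [F], since
    [P o E o F] is isomorphic to [P] ([K0_resK]).

    This homomorphism maps the alternating sum of a resolution over [G1] to the
    alternating sum of a resolution over [G2]. To compare it with an arbitrary
    obstruction over [G2] one needs that the alternating sum does not depend on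
    the resolution ([finiteness_obstruction_unique]). This is an induction on
    the length: Schanuel's lemma, an isomorphism between [K (+) Q] and [L (+) P],
    compares the first syzygies [K] and [L] of two resolutions starting with [P]
    and [Q] ([euler_class_unique]). *)

(** * Homomorphisms of modules over a category *)

Section Homs.
Variables (R : pzRingType) (G : smallCat).
Implicit Types M N P Q K L : catMod R G.
#[local] Obligation Tactic := (intros; try by []).

(** Building homomorphisms from plain functions keeps their values computable
    by conversion, so that identities between composites reduce to identities
    between elements. *)
Section MkHom.
Variables (M N : catMod R G) (h : forall x, M x -> N x).
Hypothesis h_linear : forall x, linear (@h x).
Hypothesis h_nat : forall x y (f : mor x y) m,
  h (mod_mor M f m) = mod_mor N f (h m).

Definition mk_hom_at x : {linear M x -> N x} :=
  HB.pack (@h x) (GRing.isLinear.Build R _ _ _ _ (h_linear (x := x))).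

Definition mk_hom : modHom M N := @ModHom R G M N mk_hom_at h_nat.

End MkHom.

Program Definition hom_id M : modHom M M := @mk_hom M M (fun x m => m) _ _.

Program Definition hom_comp M N P (g : modHom N P) (f : modHom M N) : modHom M P :=
  @mk_hom M P (fun x m => g x (f x m)) _ _.
Next Obligation. by move=> r p q /=; rewrite !linearP. Qed.
Next Obligation. by rewrite /= !hom_nat. Qed.

Program Definition hom_zero M N : modHom M N := @mk_hom M N (fun x m => 0) _ _.
Next Obligation. by move=> r p q /=; rewrite scaler0 addr0. Qed.
Next Obligation. by rewrite /= linear0. Qed.

Program Definition hom_add M N (f g : modHom M N) : modHom M N :=
  @mk_hom M N (fun x m => f x m + g x m) _ _.
Next Obligation. by move=> r p q /=; rewrite !linearP scalerDr addrACA. Qed.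
Next Obligation. by rewrite /= !hom_nat linearD. Qed.

Program Definition hom_sub M N (f g : modHom M N) : modHom M N :=
  @mk_hom M N (fun x m => f x m - g x m) _ _.
Next Obligation. by move=> r p q /=; rewrite !linearP scalerDr addrACA. Qed.
Next Obligation. by rewrite /= !hom_nat linearB. Qed.

Program Definition hom_fst M N : modHom (dsum M N) M :=
  @mk_hom (dsum M N) M (fun x m => m.1) _ _.

Program Definition hom_snd M N : modHom (dsum M N) N :=
  @mk_hom (dsum M N) N (fun x m => m.2) _ _.

Program Definition hom_pair M N P (f : modHom P M) (g : modHom P N) :
    modHom P (dsum M N) :=
  @mk_hom P (dsum M N) (fun x m => (f x m, g x m)) _ _.
Next Obligation. by move=> r p q /=; rewrite !linearP. Qed.
Next Obligation. by rewrite /= !hom_nat. Qed.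

Definition hom_inl M N : modHom M (dsum M N) := hom_pair (hom_id M) (hom_zero M N).

Definition hom_dsum M M' N N' (f : modHom M M') (g : modHom N N') :
    modHom (dsum M N) (dsum M' N') :=
  hom_pair (hom_comp f (hom_fst M N)) (hom_comp g (hom_snd M N)).

Lemma mod_iso_refl M : mod_iso M M.
Proof. by exists (hom_id M), (hom_id M); split. Qed.

Lemma mod_iso_sym M N : mod_iso M N -> mod_iso N M.
Proof. by case=> f [g [fK gK]]; exists g, f. Qed.

Lemma mod_iso_trans N M P : mod_iso M N -> mod_iso N P -> mod_iso M P.
Proof.
move=> [f [g [fK gK]]] [f' [g' [fK' gK']]].
exists (hom_comp f' f), (hom_comp g g').
by split=> x m; rewrite /= ?fK' ?fK ?gK ?gK'.
Qed.

Lemma dsum_iso M M' N N' :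
  mod_iso M M' -> mod_iso N N' -> mod_iso (dsum M N) (dsum M' N').
Proof.
move=> [f [g [fK gK]]] [f' [g' [fK' gK']]].
exists (hom_dsum f f'), (hom_dsum g g').
by split=> x [m n] /=; rewrite ?fK ?fK' ?gK ?gK'.
Qed.

Lemma dsumACA M N P Q :
  mod_iso (dsum (dsum M N) (dsum P Q)) (dsum (dsum M P) (dsum N Q)).
Proof.
pose swap (A B C D : catMod R G) :
    modHom (dsum (dsum A B) (dsum C D)) (dsum (dsum A C) (dsum B D)) :=
  hom_pair (hom_dsum (hom_fst A B) (hom_fst C D))
           (hom_dsum (hom_snd A B) (hom_snd C D)).
by exists (swap M N P Q), (swap M P N Q); split=> x [[a b] [c d]].
Qed.

Lemma dsumA M N P : mod_iso (dsum M (dsum N P)) (dsum (dsum M N) P).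
Proof.
exists (hom_pair (hom_dsum (hom_id M) (hom_fst N P))
                 (hom_comp (hom_snd N P) (hom_snd M (dsum N P)))).
exists (hom_pair (hom_comp (hom_fst M N) (hom_fst (dsum M N) P))
                 (hom_dsum (hom_snd M N) (hom_id P))).
by split=> x; [case=> a [b c]|case=> [[a b] c]].
Qed.

Lemma zero_modP : is_zero_mod (zero_mod R G).
Proof. by move=> x m; apply/rowP; case. Qed.

Lemma zero_iso M N : is_zero_mod M -> is_zero_mod N -> mod_iso M N.
Proof.
move=> M0 N0; exists (hom_zero M N), (hom_zero N M).
by split=> x m; rewrite ?[m]M0 ?[m]N0.
Qed.

Lemma dsum0 M : mod_iso M (dsum (zero_mod R G) M).
Proof.
exists (hom_pair (hom_zero M _) (hom_id M)), (hom_snd _ M).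
by split=> x // -[a b] /=; congr pair; exact/esym/zero_modP.
Qed.

(** * Kernels *)

Section LinKernel.
Variables (U V : lmodType R) (h : {linear U -> V}).

Definition ker_pred : {pred U} := fun u => h u == 0.

Fact ker_pred_submod : subsemimod_closed ker_pred.
Proof.
split; first split=> [|u v /eqP hu /eqP hv]; first 1 last.
- by apply/eqP; rewrite linearD hu hv addr0.
- by move=> r u /eqP hu; apply/eqP; rewrite linearZ /= hu scaler0.
- by apply/eqP; rewrite linear0.
Qed.

HB.instance Definition _ := GRing.isSubmodClosed.Build R U ker_pred ker_pred_submod.

Record ker_type := KerElt { ker_val : U; ker_valP : ker_val \in ker_pred }.

HB.instance Definition _ := [isSub for ker_val].
HB.instance Definition _ := [Choice of ker_type by <:].
HB.instance Definition _ := [SubChoice_isSubLmodule of ker_type by <:].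

End LinKernel.

Section Kernel.
Variables (M N : catMod R G) (f : modHom M N).

Let kerM x : lmodType R := ker_type (f x).

Lemma ker_morP x y (a : mor x y) (m : kerM y) :
  mod_mor M a (val m) \in ker_pred (f x).
Proof. by apply/eqP; rewrite hom_nat (eqP (ker_valP m)) linear0. Qed.

Definition ker_mor_fun x y (a : mor x y) (m : kerM y) : kerM x :=
  KerElt (ker_morP a m).

Lemma ker_mor_linear x y (a : mor x y) : linear (ker_mor_fun a).
Proof. by move=> r p q; apply: val_inj; rewrite /= !linearP. Qed.

Definition ker_mor x y (a : mor x y) : {linear kerM y -> kerM x} :=
  HB.pack (ker_mor_fun a) (GRing.isLinear.Build R _ _ _ _ (ker_mor_linear a)).

Lemma ker_mor1 x m : ker_mor (idm x) m = m.
Proof. by apply: val_inj; rewrite /= mod_mor1. Qed.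

Lemma ker_morM x y z (g : mor y z) (a : mor x y) m :
  ker_mor (g \c a) m = ker_mor a (ker_mor g m).
Proof. by apply: val_inj; rewrite /= mod_morM. Qed.

Definition ker_mod : catMod R G := CatMod ker_mor1 ker_morM.

Program Definition ker_incl : modHom ker_mod M :=
  @mk_hom ker_mod M (fun x m => val m) _ _.

Lemma ker_incl_inj : mod_inj ker_incl.
Proof. by move=> x m n /val_inj. Qed.

Lemma ker_incl_exact : exact_at ker_incl f.
Proof.
move=> x n; split=> [fn|[[m /eqP fm] <-] //].
by have kn : n \in ker_pred (f x) by [exact/eqP]; exists (KerElt kn).
Qed.

End Kernel.

(** The universal property of the kernel, for any monomorphism [i] that
    represents it. *)
Lemma factor_kernel K P M X (i : modHom K P) (f : modHom P M) (h : modHom X P) :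
  mod_inj i -> exact_at i f -> (forall x m, f x (h x m) = 0) ->
  exists k : modHom X K, forall x m, i x (k x m) = h x m.
Proof.
move=> i_inj i_ex fh0.
have ex x m : exists n, i x n = h x m by apply/i_ex.
pose k x (m : X x) : K x := sval (cid (ex x m)).
have kE x m : i x (k x m) = h x m by rewrite /k; case: cid.
have k_lin x : linear (@k x).
  by move=> r p q; apply: i_inj; rewrite linearP !kE linearP.
have k_nat x y (a : mor x y) m : k x (mod_mor X a m) = mod_mor K a (k y m).
  by apply: i_inj; rewrite hom_nat !kE hom_nat.
by exists (mk_hom k_lin k_nat).
Qed.

(** * Projective modules *)

Definition projective P : Prop :=
  forall M N (g : modHom M N) (h : modHom P N), mod_surj g ->
    exists k : modHom P M, forall x p, g x (k x p) = h x p.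

(** A direct summand inherits the lifting property: extend by zero on the
    complement, lift, and restrict. *)
Lemma projective_retract P L (s : modHom P L) (r : modHom L P) :
  (forall x p, r x (s x p) = p) -> projective L -> projective P.
Proof.
move=> rsK Lproj M N g h g_surj.
have [k kE] := Lproj M N g (hom_comp h r) g_surj.
by exists (hom_comp k s) => x p; rewrite [LHS]kE /= rsK.
Qed.

Lemma projective_dsum P Q : projective P -> projective Q -> projective (dsum P Q).
Proof.
move=> Pproj Qproj M N g h g_surj.
have [k kE] := Pproj M N g (hom_comp h (hom_inl P Q)) g_surj.
have [l lE] := Qproj M N g
  (hom_comp h (hom_pair (hom_zero Q P) (hom_id Q))) g_surj.
exists (hom_add (hom_comp k (hom_fst P Q)) (hom_comp l (hom_snd P Q))) => x [p q] /=.
by rewrite linearD kE lE /= -linearD /= -[in RHS](addr0 p) -[in RHS](add0r q).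
Qed.

Lemma projective_zero M : is_zero_mod M -> projective M.
Proof.
by move=> M0 A B g h _; exists (hom_zero _ _) => x p; rewrite [p]M0 !linear0.
Qed.

Section Yoneda.
Variables (z : G) (M : catMod R G) (m : M z).

Let ev y (f : mor y z) : M y := mod_mor M f m.

Definition yoneda_at y : {linear rep_mod R z y -> M y} :=
  lin_lift (@no_rel_lift R _ _ (@ev y)).

Lemma yoneda_gen y (f : mor y z) : yoneda_at y (fgen R f) = mod_mor M f m.
Proof. exact: (plift_gen (@no_rel_lift R _ _ (@ev y))). Qed.

Lemma yoneda_nat x y (f : mor x y) p :
  yoneda_at x (mod_mor (rep_mod R z) f p) = mod_mor M f (yoneda_at y p).
Proof.
elim/presented_ind: p => [|s|p q IHp IHq|r p IHp].
- by rewrite !linear0.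
- by rewrite [mod_mor _ _ _]free_map_gen !yoneda_gen mod_morM.
- by rewrite !linearD IHp IHq.
- by rewrite !linearZ IHp.
Qed.

Definition yoneda : modHom (rep_mod R z) M := ModHom yoneda_nat.

End Yoneda.

Lemma rep_hom_ext z M (g h : modHom (rep_mod R z) M) :
  g z (fgen R (idm z)) = h z (fgen R (idm z)) -> forall y p, g y p = h y p.
Proof.
move=> gh y; apply: presented_ind => [|f|p q IHp IHq|r p IHp].
- by rewrite !linear0.
- have -> : pgen (@no_rel R (mor y z)) f =
             mod_mor (rep_mod R z) f (fgen R (idm z)).
    by rewrite [RHS]free_map_gen ccomp1m.
  by rewrite !hom_nat gh.
- by rewrite !linearD IHp IHq.
- by rewrite !linearZ IHp.
Qed.

(** By the Yoneda lemma, lifting a homomorphism out of a representable module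
    amounts to lifting the image of the identity. *)
Lemma projective_rep z : projective (rep_mod R z).
Proof.
move=> M N g h g_surj; have [m mE] := g_surj z (h z (fgen R (idm z))).
exists (yoneda m) => x p; apply: (rep_hom_ext (g := hom_comp g (yoneda m))).
rewrite -mE -[m in RHS]mod_mor1 /=; congr (g z _); exact: yoneda_gen.
Qed.

Lemma projective_free (s : seq G) : projective (free_mod R s).
Proof.
elim: s => [|x s IHs]; first exact/projective_zero/zero_modP.
exact/projective_dsum/IHs/projective_rep.
Qed.

Lemma fg_proj_projective P : fg_proj P -> projective P.
Proof.
move=> [Q [L [[s [f [g [fK _]]]] [h [k [hK _]]]]]].
apply: (projective_retract (s := hom_comp f (hom_comp h (hom_inl P Q)))
  (r := hom_comp (hom_fst P Q) (hom_comp k g)) _ (@projective_free s)).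
by move=> x p; rewrite /= fK hK.
Qed.

Lemma fg_proj_iso M N : mod_iso M N -> fg_proj N -> fg_proj M.
Proof.
move=> MN [Q [L [Lfree NQL]]]; exists Q, L; split=> //.
exact: mod_iso_trans (dsum_iso MN (mod_iso_refl Q)) NQL.
Qed.

Lemma free_mod_cat (s t : seq G) :
  mod_iso (dsum (free_mod R s) (free_mod R t)) (free_mod R (s ++ t)).
Proof.
elim: s => [|x s IHs] /=; first exact/mod_iso_sym/dsum0.
apply: mod_iso_trans (mod_iso_sym (dsumA _ _ _)) _.
exact: dsum_iso (mod_iso_refl _) IHs.
Qed.

Lemma fg_free_dsum M N : fg_free M -> fg_free N -> fg_free (dsum M N).
Proof.
move=> [s Ms] [t Nt]; exists (s ++ t).
exact: mod_iso_trans (dsum_iso Ms Nt) (free_mod_cat s t).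
Qed.

Lemma fg_proj_dsum M N : fg_proj M -> fg_proj N -> fg_proj (dsum M N).
Proof.
move=> [P [K [Kfree MP]]] [Q [L [Lfree NQ]]].
exists (dsum P Q), (dsum K L); split; first exact: fg_free_dsum.
exact: mod_iso_trans (dsumACA _ _ _ _) (dsum_iso MP NQ).
Qed.

Lemma fg_proj_zero M : is_zero_mod M -> fg_proj M.
Proof.
move=> M0; apply: (fg_proj_iso (zero_iso M0 zero_modP)).
exists (zero_mod R G), (zero_mod R G); split; last exact/mod_iso_sym/dsum0.
by exists [::]; exact: mod_iso_refl.
Qed.

(** * Schanuel's lemma *)

(** Given lifts [a : P -> Q] and [b : Q -> P] of the identity of [M], the
    mutually inverse homomorphisms are
    [(k, q) |-> (q - a (k + b q), k + b q)] and
    [(l, p) |-> (p - b (l + a p), l + a p)], whose first components lie in the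
    respective kernels. *)
Lemma schanuel K P L Q M : projective P -> projective Q ->
  short_exact K P M -> short_exact L Q M -> mod_iso (dsum K Q) (dsum L P).
Proof.
move=> Pproj Qproj [i [f [i_inj i_ex f_surj]]] [j [g [j_inj j_ex g_surj]]].
have [a ga] := Pproj _ _ g f g_surj; have [b fb] := Qproj _ _ f g f_surj.
pose u := hom_add (hom_comp i (hom_fst K Q)) (hom_comp b (hom_snd K Q)).
pose v := hom_add (hom_comp j (hom_fst L P)) (hom_comp a (hom_snd L P)).
have fi0 x k : f x (i x k) = 0 by apply/i_ex; exists k.
have gj0 x l : g x (j x l) = 0 by apply/j_ex; exists l.
have [u' u'E] : exists u' : modHom (dsum K Q) L, forall x m,
    j x (u' x m) = m.2 - a x (u x m).
  apply: (factor_kernel (h := hom_sub (hom_snd K Q) (hom_comp a u)) j_inj j_ex).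
  by move=> x m /=; rewrite linearB ga linearD fi0 fb add0r subrr.
have [v' v'E] : exists v' : modHom (dsum L P) K, forall x m,
    i x (v' x m) = m.2 - b x (v x m).
  apply: (factor_kernel (h := hom_sub (hom_snd L P) (hom_comp b v)) i_inj i_ex).
  by move=> x m /=; rewrite linearB fb linearD gj0 ga add0r subrr.
exists (hom_pair u' u), (hom_pair v' v); split=> x [m n] /=.
  have vE : v x (u' x (m, n), u x (m, n)) = n by rewrite /= u'E subrK.
  congr pair => //; apply: i_inj; rewrite v'E vE /=.
  by rewrite addrK.
have uE : u x (v' x (m, n), v x (m, n)) = n by rewrite /= v'E subrK.
congr pair => //; apply: j_inj; rewrite u'E uE /=.
by rewrite addrK.
Qed.

End Homs.

(** * The Euler class of a module with a finite projective resolution *)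

Section Euler.
Variables (R : pzRingType) (G : smallCat).
Implicit Types (M N K L : catMod R G) (P Q : fgProj R G) (u v w : K0 R G).

Lemma K0addr0 u : K0add u (K0zero R G) = u.
Proof. by rewrite K0addC K0add0. Qed.

Lemma K0addrN u : K0add u (K0opp u) = K0zero R G.
Proof. by rewrite K0addC K0addN. Qed.

Lemma K0addI u v w : K0add u v = K0add u w -> v = w.
Proof.
by move=> /(congr1 (K0add (K0opp u))); rewrite !K0addA K0addN !K0add0.
Qed.

Lemma K0addACA u v w t :
  K0add (K0add u v) (K0add w t) = K0add (K0add u w) (K0add v t).
Proof. by rewrite -!K0addA; congr K0add; rewrite !K0addA (K0addC v). Qed.

Lemma K0oppD u v : K0opp (K0add u v) = K0add (K0opp u) (K0opp v).
Proof. by apply: (@K0addI (K0add u v)); rewrite K0addACA !K0addrN K0add0. Qed.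

Lemma K0oppK u : K0opp (K0opp u) = u.
Proof. by apply: (@K0addI (K0opp u)); rewrite K0addrN K0addN. Qed.

Lemma K0sub_swap (p q a b : K0 R G) :
  K0add a q = K0add b p -> K0add p (K0opp a) = K0add q (K0opp b).
Proof.
move=> abE; apply: (@K0addI (K0add a b)).
rewrite (K0addC p) K0addACA K0addrN (K0addC a b) (K0addC q) K0addACA K0addrN.
by rewrite abE.
Qed.

Lemma K0opp0 : K0opp (K0zero R G) = K0zero R G.
Proof. by rewrite -[LHS]K0add0 K0addrN. Qed.

Lemma K0gen_iso P Q : mod_iso P Q -> K0gen P = K0gen Q.
Proof. by move=> PQ; apply/K0classP; exact: K0rel_iso. Qed.

Lemma K0gen_ses P0 P1 P2 : short_exact P0 P1 P2 ->
  K0gen P1 = K0add (K0gen P0) (K0gen P2).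
Proof.
move=> /K0rel_ses /K0classP; rewrite -!K0add_class -K0opp_class => ses.
apply: (@K0addI (K0opp (K0gen P1))); rewrite K0addN K0addA.
by rewrite [K0add (K0opp _) _]K0addC.
Qed.

Lemma dsum_ses M N : short_exact M (dsum M N) N.
Proof.
exists (hom_inl M N), (hom_snd M N); split=> [x m n []//|x [m n]|x n].
  by split=> /= [->|[_ [_ <-]] //]; exists m.
by exists (0, n).
Qed.

Definition fgProj_dsum P Q : fgProj R G := FgProj (fg_proj_dsum (fgpP P) (fgpP Q)).

Lemma K0gen_dsum P Q : K0gen (fgProj_dsum P Q) = K0add (K0gen P) (K0gen Q).
Proof. by apply: K0gen_ses; exact: dsum_ses. Qed.

(** [[P] + [P] = [P]], because [dsum P P] is isomorphic to [P]. *)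
Lemma K0gen_zero P : is_zero_mod P -> K0gen P = K0zero R G.
Proof.
move=> P0; apply: (@K0addI (K0gen P)); rewrite K0addr0 -K0gen_dsum.
apply: K0gen_iso; apply: mod_iso_trans (mod_iso_sym (dsum0 P)).
exact: dsum_iso (zero_iso P0 (@zero_modP R G)) (mod_iso_refl P).
Qed.

Lemma short_exact_isor K N M M' :
  mod_iso M M' -> short_exact K N M -> short_exact K N M'.
Proof.
move=> [a [b [aK bK]]] [f [g [f_inj f_ex g_surj]]].
exists f, (hom_comp a g); split=> // [x n|x m'] /=.
  split=> [agn|/f_ex ->]; last by rewrite linear0.
  by apply/f_ex; rewrite -[LHS]aK agn linear0.
by have [n gn] := g_surj x (b x m'); exists n; rewrite gn bK.
Qed.

Lemma short_exact_dsumr K N M Q :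
  short_exact K N M -> short_exact K (dsum N Q) (dsum M Q).
Proof.
move=> [f [g [f_inj f_ex g_surj]]].
exists (hom_comp (hom_inl N Q) f), (hom_dsum g (hom_id Q)); split.
- by move=> x m n [] /f_inj.
- move=> x [n q] /=; split=> [[/f_ex [m <-] ->]|[m [<- <-]]]; first by exists m.
  by congr pair; apply/f_ex; exists m.
- by move=> x [m q]; have [n <-] := g_surj x m; exists (n, q).
Qed.

(** [euler_class n M u] holds if [M] has a resolution of length at most [n] by
    finitely generated projective modules with alternating sum [u]; recursing on
    the first syzygy [K] makes Schanuel's lemma applicable at each step. *)
Fixpoint euler_class (n : nat) M u : Prop :=
  if n is n'.+1 then
    exists K P v, [/\ short_exact K P M, euler_class n' K v &
                      u = K0add (K0gen P) (K0opp v)]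
  else exists P, mod_iso P M /\ u = K0gen P.

Lemma euler_class_iso n M M' u :
  mod_iso M M' -> euler_class n M u -> euler_class n M' u.
Proof.
move=> MM'; case: n => [[P [PM ->]]|n [K [P [v [ses Kv ->]]]]] /=.
  by exists P; split=> //; exact: mod_iso_trans MM'.
by exists K, P, v; split=> //; exact: short_exact_isor ses.
Qed.

(** Only the first step of the resolution changes: the syzygy of [dsum M Q] may
    be taken to be that of [M], which is why no induction is needed. *)
Lemma euler_class_dsum n M u Q :
  euler_class n M u -> euler_class n (dsum M Q) (K0add u (K0gen Q)).
Proof.
case: n => [[P [PM ->]]|n [K [P [v [ses Kv ->]]]]] /=.
  exists (fgProj_dsum P Q); rewrite K0gen_dsum; split=> //.
  exact: dsum_iso (mod_iso_refl Q).
exists K, (fgProj_dsum P Q), v; rewrite K0gen_dsum; split=> //.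
  exact: short_exact_dsumr.
by rewrite -!K0addA [K0add (K0gen Q) _]K0addC.
Qed.

Lemma euler_class_zero M : is_zero_mod M -> euler_class 0 M (K0zero R G).
Proof.
move=> M0; exists (FgProj (fg_proj_zero M0)); split; first exact: mod_iso_refl.
by rewrite K0gen_zero.
Qed.

(** The length may be raised by resolving a projective module by itself, with
    zero syzygy; two resolutions can thus be given the same length. *)
Lemma euler_classS n M u : euler_class n M u -> euler_class n.+1 M u.
Proof.
elim: n M u => [|n IHn] M u; last first.
  move=> [K [P [v [ses /IHn Kv ->]]]].
  by exists K, P, v.
move=> [P [PM ->]]; exists (zero_mod R G), P, (K0zero R G); split.
- apply: (short_exact_isor PM); exists (hom_zero _ _), (hom_id P).
  split=> [x m n _|x p|x p]; last by exists p.
  + by rewrite (zero_modP m) (zero_modP n).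
  + by split=> /= [->|[_ ->] //]; exists 0.
- exact/euler_class_zero/zero_modP.
- by rewrite K0opp0 K0addr0.
Qed.

Lemma euler_class_le m n M u : (m <= n)%N -> euler_class m M u -> euler_class n M u.
Proof.
move=> /subnK <-; elim: (n - m)%N => // k IHk Mu; exact/euler_classS/IHk.
Qed.

(** For resolutions of the same length, Schanuel's lemma identifies the first
    syzygies up to adding the zeroth terms, so the classes of the syzygies
    plus those terms agree by induction. *)
Lemma euler_class_unique m n M u v :
  euler_class m M u -> euler_class n M v -> u = v.
Proof.
move=> /(euler_class_le (leq_maxl m n)) Mu /(euler_class_le (leq_maxr m n)).
elim: (maxn m n) M u v Mu => [|k IHk] M u v /=.
  move=> [P [PM ->]] [Q [QM ->]]; apply: K0gen_iso.
  exact: mod_iso_trans (mod_iso_sym QM).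
move=> [K [P [a [sesP Ka ->]]]] [L [Q [b [sesQ Lb ->]]]].
have KQ := schanuel (fg_proj_projective (fgpP P)) (fg_proj_projective (fgpP Q)) sesP sesQ.
have := IHk _ _ _ (euler_class_iso KQ (euler_class_dsum Q Ka)) (euler_class_dsum P Lb).
exact: K0sub_swap.
Qed.

(** Dropping the zeroth term resolves the first syzygy: the last differential
    corestricts to the kernel of the augmentation, onto which it is surjective
    by exactness. *)
Lemma resolution_syzygy M (P : resolution M) : exists (K : catMod R G)
    (P' : resolution K), short_exact K (P 0%N) M /\ forall n, P' n = P n.+1.
Proof.
set f := res_aug P; set i := ker_incl f.
have i_inj : mod_inj i := @ker_incl_inj _ _ _ _ f.
have i_ex : exact_at i f := @ker_incl_exact _ _ _ _ f.
have [|d dE] := factor_kernel (h := res_d P 0%N) i_inj i_ex.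
  by move=> x m; apply/res_exact0; exists m.
have d_ex : exact_at (res_d P 1%N) d.
  move=> x n; rewrite -res_exact -dE; split=> [->|e]; first exact: linear0.
  by apply: i_inj; rewrite linear0.
have d_surj : mod_surj d.
  move=> x n; have /res_exact0 [m dm] : f x (i x n) = 0 by apply/i_ex; exists n.
  by exists m; apply: i_inj; rewrite dE.
exists (ker_mod f), (Resolution (fun n => @res_exact _ _ _ P n.+1) d_ex d_surj).
by split=> //; exists i, f; split=> //; exact: res_surj.
Qed.

Lemma eq_K0altsum (P Q : nat -> fgProj R G) (N : nat) :
  P =1 Q -> K0altsum P N = K0altsum Q N.
Proof. by move=> PQ; elim: N => //= N ->; rewrite PQ. Qed.

Lemma K0altsumS (P : nat -> fgProj R G) (N : nat) :
  K0altsum P N.+1 =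
  K0add (K0altsum P N) (if odd N then K0opp (K0gen (P N)) else K0gen (P N)).
Proof. by []. Qed.

Lemma K0altsum_recl (P : nat -> fgProj R G) (N : nat) :
  K0altsum P N.+1 =
  K0add (K0gen (P 0%N)) (K0opp (K0altsum (fun n => P n.+1) N)).
Proof.
elim: N => [|N IHN]; first by rewrite /K0altsum /= K0opp0 K0addC.
rewrite K0altsumS IHN [K0altsum _ N.+1]K0altsumS K0oppD -K0addA /=.
by case: (odd N); rewrite /= ?K0oppK.
Qed.

Lemma euler_class_resolution M (P : resolution M) (N : nat)
    (Pproj : forall n, fg_proj (P n)) : vanishes_from P N ->
  euler_class N M (K0altsum (fun n => FgProj (Pproj n)) N).
Proof.
elim: N M P Pproj => [|N IHN] M P Pproj P0.
  apply: euler_class_zero => x m; have [p <-] := res_surj P m.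
  by rewrite (P0 0%N _ _ p) ?linear0.
have [K [P' [ses P'E]]] := resolution_syzygy P.
have P'proj n : fg_proj (P' n) by rewrite P'E.
exists K, (FgProj (Pproj 0%N)), (K0altsum (fun n => FgProj (P'proj n)) N).
split=> //; first by apply: IHN => n Nn; rewrite P'E; exact: P0.
rewrite K0altsum_recl; congr (K0add _ (K0opp _)); apply: eq_K0altsum => n.
by move: (P'proj n); rewrite P'E => ?; congr FgProj; exact: Prop_irrelevance.
Qed.

Lemma finiteness_obstruction_unique (o o' : K0 R G) :
  is_finiteness_obstruction o -> is_finiteness_obstruction o' -> o = o'.
Proof.
move=> [P [m [Pproj [Pm ->]]]] [Q [n [Qproj [Qn ->]]]].
exact: euler_class_unique (euler_class_resolution Pproj Pm)
                          (euler_class_resolution Qproj Qn).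
Qed.

End Euler.

(** * Restriction along a functor *)

Section Restriction.
Variables (R : pzRingType) (G1 G2 : smallCat) (E : catFun G2 G1).
Implicit Types M N P : catMod R G1.

Lemma res_mor1 M x (m : M (E x)) : mod_mor M (fun_mor E (idm x)) m = m.
Proof. by rewrite fun_mor1 mod_mor1. Qed.

Lemma res_morM M x y z (g : mor y z) (f : mor x y) (m : M (E z)) :
  mod_mor M (fun_mor E (g \c f)) m = mod_mor M (fun_mor E f) (mod_mor M (fun_mor E g) m).
Proof. by rewrite fun_morM mod_morM. Qed.

Definition res_mod M : catMod R G2 :=
  @CatMod R G2 (fun z => M (E z)) (fun x y f => mod_mor M (fun_mor E f))
    (@res_mor1 M) (@res_morM M).

Definition res_hom M N (f : modHom M N) : modHom (res_mod M) (res_mod N) :=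
  @ModHom R G2 (res_mod M) (res_mod N) (fun z => f (E z))
    (fun x y a m => hom_nat f (fun_mor E a) m).

Lemma res_iso M N : mod_iso M N -> mod_iso (res_mod M) (res_mod N).
Proof.
case=> f [g [fK gK]]; exists (res_hom f), (res_hom g).
by split=> x m; [exact: fK|exact: gK].
Qed.

Lemma res_dsum M N :
  mod_iso (res_mod (dsum M N)) (dsum (res_mod M) (res_mod N)).
Proof.
exists (hom_pair (res_hom (hom_fst M N)) (res_hom (hom_snd M N))).
by exists (@mk_hom R G2 (dsum (res_mod M) (res_mod N)) (res_mod (dsum M N))
            (fun x m => m) (fun x r p q => erefl) (fun x y f m => erefl));
  split=> x [].
Qed.

Lemma res_zero M : is_zero_mod M -> is_zero_mod (res_mod M).
Proof. by move=> M0 x m; exact: M0. Qed.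

Lemma res_ses M N P : short_exact M N P ->
  short_exact (res_mod M) (res_mod N) (res_mod P).
Proof.
move=> [f [g [f_inj f_ex g_surj]]]; exists (res_hom f), (res_hom g).
by split=> [x|x|x]; [exact: f_inj|exact: f_ex|exact: g_surj].
Qed.

(** Constant modules restrict to constant modules, whose values agree on the
    nose, so restriction carries resolutions of one to resolutions of the
    other. *)
Definition res_resolution (P : resolution (const_mod R G1)) :
    resolution (const_mod R G2) :=
  @Resolution R G2 (const_mod R G2) (fun n => res_mod (P n))
    (fun n => res_hom (res_d P n))
    (@ModHom R G2 (res_mod (P 0%N)) (const_mod R G2) (fun z => res_aug P (E z))
      (fun x y a m => hom_nat (res_aug P) (fun_mor E a) m))
    (fun n z => @res_exact _ _ _ P n (E z))
    (fun z => @res_exact0 _ _ _ P (E z))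
    (fun z => @res_surj _ _ _ P (E z)).

End Restriction.

(** * Equivalences and hom-set bijections *)

Lemma nat_isoE (G1 G2 : smallCat) (F E : catFun G1 G2) : nat_iso F E ->
  exists (t : forall x, mor (F x) (E x)) (s : forall x, mor (E x) (F x)),
    [/\ forall x y (f : mor x y), t y \c fun_mor F f = fun_mor E f \c t x,
        forall x y (f : mor x y), s y \c fun_mor E f = fun_mor F f \c s x,
        forall x, s x \c t x = idm (F x) & forall x, t x \c s x = idm (E x)].
Proof.
move=> [t [t_nat t_iso]].
pose s x := sval (cid (t_iso x)).
have stK x : s x \c t x = idm (F x) by rewrite /s; case: cid => g [].
have tsK x : t x \c s x = idm (E x) by rewrite /s; case: cid => g [].
exists t, s; split=> // x y f.
rewrite -[LHS]ccompm1 -tsK ccompA -[s y \c _ \c _]ccompA -t_nat.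
by rewrite ccompA stK ccomp1m.
Qed.

(** A functor with a left quasi-inverse is faithful: [f] is recovered from its
    image by conjugating with the natural isomorphism. *)
Lemma nat_iso_faithful (G1 G2 : smallCat) (F : catFun G1 G2) (E : catFun G2 G1)
    (x y : G1) (f g : mor x y) :
  nat_iso (compFun E F) (idFun G1) -> fun_mor F f = fun_mor F g -> f = g.
Proof.
move=> /nat_isoE [t [s [t_nat _ _ tsK]]] Ffg.
have fE (h : mor x y) : h = t y \c fun_mor E (fun_mor F h) \c s x.
  by have /= -> := t_nat _ _ h; rewrite -ccompA tsK ccompm1.
by rewrite (fE f) Ffg -fE.
Qed.

(** [E] is left adjoint to [F]; for an equivalence it is also right adjoint. *)
Record adjunction (G1 G2 : smallCat) (E : catFun G2 G1) (F : catFun G1 G2) := Adjunction {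
  adj_tr : forall z x, mor (E z) x -> mor z (F x);
  adj_inv : forall z x, mor z (F x) -> mor (E z) x;
  adj_trK : forall z x (h : mor (E z) x), adj_inv (adj_tr h) = h;
  adj_invK : forall z x (k : mor z (F x)), adj_tr (adj_inv k) = k;
  adj_natl : forall w z x (g : mor w z) (h : mor (E z) x),
    adj_tr (h \c fun_mor E g) = adj_tr h \c g;
  adj_natr : forall z x y (f : mor x y) (h : mor (E z) x),
    adj_tr (f \c h) = fun_mor F f \c adj_tr h }.

(** The natural isomorphisms of an equivalence need not satisfy the triangle
    identities, so the inverse of [h |-> F h \c u_z], with [u_z : z -> F (E z)],
    is not written down from them; instead the map is shown to be bijective,
    because both functors are faithful. *)
Lemma equivalence_adjunction (G1 G2 : smallCat) (E : catFun G2 G1) (F : catFun G1 G2) :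
  nat_iso (compFun E F) (idFun G1) -> nat_iso (compFun F E) (idFun G2) ->
  inhabited (adjunction E F).
Proof.
move=> EF FE; have [t [t' [t_nat _ t'tK tt'K]]] := nat_isoE EF.
have [u [u' [_ u'_nat u'uK uu'K]]] := nat_isoE FE.
pose tr z x (h : mor (E z) x) : mor z (F x) := fun_mor F h \c u' z.
have tr_inj z x (h k : mor (E z) x) : tr z x h = tr z x k -> h = k.
  move=> hk; apply: nat_iso_faithful EF _.
  by rewrite -[LHS]ccompm1 -[RHS]ccompm1 -u'uK !ccompA -/(tr z x h) hk.
have tr_surj z x (k : mor z (F x)) : exists h, tr z x h = k.
  (* [E (F h) = E (k \c u_z)] for the conjugate [h] of the right-hand side. *)
  pose h := t x \c fun_mor E (k \c u z) \c t' (E z).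
  exists h; have Fh : fun_mor F h = k \c u z.
    apply: nat_iso_faithful FE _.
    rewrite -[LHS]ccomp1m -t'tK -ccompA; have /= -> := t_nat _ _ h.
    rewrite /h -[in LHS](ccompA _ _ (t (E z))).
    by rewrite t'tK ccompm1 ccompA t'tK ccomp1m.
  by rewrite /tr Fh -ccompA uu'K ccompm1.
pose inv z x k := sval (cid (tr_surj z x k)).
have invK z x k : tr z x (inv z x k) = k by rewrite /inv; case: cid.
constructor; apply: (@Adjunction _ _ E F tr inv) => //.
- by move=> z x h; apply: tr_inj; rewrite invK.
- move=> w z x g h; rewrite /tr fun_morM -!ccompA; congr (_ \c _).
  by have /= -> := u'_nat _ _ g.
- by move=> z x y f h; rewrite /tr fun_morM ccompA.
Qed.

(** Linearity and naturality of the inverse come for free from injectivity of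
    [f], so only its values have to be given. *)
Lemma pointwise_iso (R : pzRingType) (G : smallCat) (M N : catMod R G)
    (f : modHom M N) (g : forall x, N x -> M x) :
  (forall x m, g x (f x m) = m) -> (forall x n, f x (g x n) = n) -> mod_iso M N.
Proof.
move=> fK gK; have f_inj x : injective (f x) by exact: can_inj (fK x).
have g_lin x : linear (g x).
  by move=> r p q; apply: f_inj; rewrite linearP !gK.
have g_nat x y (a : mor x y) n : g x (mod_mor N a n) = mod_mor M a (g y n).
  by apply: f_inj; rewrite hom_nat !gK.
by exists f, (mk_hom g_lin g_nat).
Qed.

(** * Restriction along a left adjoint *)

Section RestrictionAdjoint.
Variables (R : pzRingType) (G1 G2 : smallCat).
Variables (E : catFun G2 G1) (F : catFun G1 G2) (A : adjunction E F).

(** The adjunction bijection, extended linearly. *)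
Lemma res_rep x : mod_iso (res_mod E (rep_mod R x)) (rep_mod R (F x)).
Proof.
pose tr z : {linear res_mod E (rep_mod R x) z -> rep_mod R (F x) z} :=
  free_map R (@adj_tr _ _ _ _ A z x).
have tr_nat w z (g : mor w z) m :
    tr w (mod_mor (res_mod E (rep_mod R x)) g m) = mod_mor (rep_mod R (F x)) g (tr z m).
  transitivity (free_map R (fun h => adj_tr A (h \c fun_mor E g)) m).
    by symmetry; apply: free_map_comp.
  by apply: free_map_comp => h; exact: adj_natl.
apply: (pointwise_iso (f := ModHom tr_nat)
                      (g := fun z => free_map R (@adj_inv _ _ _ _ A z x))) => z m.
- rewrite -(free_map_comp (h := id)) ?free_map_id // => h.
  by rewrite adj_trK.
- transitivity (free_map R (fun k : mor z (F x) => k) m); last exact: free_map_id.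
  by symmetry; apply: free_map_comp => h; rewrite adj_invK.
Qed.

Lemma res_free (s : seq G1) :
  mod_iso (res_mod E (free_mod R s)) (free_mod R (map F s)).
Proof.
elim: s => [|x s IHs] /=.
  by apply: zero_iso => [|z m]; [apply: res_zero => z m|]; exact: zero_modP.
exact: mod_iso_trans (res_dsum _ _ _) (dsum_iso (res_rep x) IHs).
Qed.

Lemma fg_free_res (M : catMod R G1) : fg_free M -> fg_free (res_mod E M).
Proof.
by move=> [s Ms]; exists (map F s); exact: mod_iso_trans (res_iso E Ms) (res_free s).
Qed.

Lemma fg_proj_res (P : catMod R G1) : fg_proj P -> fg_proj (res_mod E P).
Proof.
move=> [Q [L [Lfree PQL]]]; exists (res_mod E Q), (res_mod E L).
split; first exact: fg_free_res.
exact: mod_iso_trans (mod_iso_sym (res_dsum _ _ _)) (res_iso E PQL).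
Qed.

Lemma vanishes_res (P : resolution (const_mod R G1)) N :
  vanishes_from P N -> vanishes_from (res_resolution E P) N.
Proof. by move=> P0 n Nn; exact/res_zero/P0. Qed.

Lemma type_FP_res : type_FP R G1 -> type_FP R G2.
Proof.
move=> [P [[N P0] Pproj]]; exists (res_resolution E P).
by split=> [|n]; [exists N; exact: vanishes_res|exact: fg_proj_res].
Qed.

Lemma type_FF_res : type_FF R G1 -> type_FF R G2.
Proof.
move=> [P [[N P0] Pfree]]; exists (res_resolution E P).
by split=> [|n]; [exists N; exact: vanishes_res|exact: fg_free_res].
Qed.

Definition fgProj_res (P : fgProj R G1) : fgProj R G2 := FgProj (fg_proj_res (fgpP P)).

Fixpoint K0term_res (a : K0term R G1) : K0term R G2 :=
  match a with
  | K0Tzero => K0Tzero R G2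
  | K0Tgen P => K0Tgen (fgProj_res P)
  | K0Tadd a b => K0Tadd (K0term_res a) (K0term_res b)
  | K0Topp a => K0Topp (K0term_res a)
  end.

Lemma K0term_res_rel a b : K0rel a b -> K0rel (K0term_res a) (K0term_res b).
Proof.
elim=> {a b} /=.
- by move=> P Q PQ; apply: K0rel_iso; exact: res_iso.
- by move=> P0 P1 P2 ses; apply: K0rel_ses; exact: res_ses.
- by move=> a; exact: K0rel_refl.
- by move=> a b _; exact: K0rel_sym.
- by move=> a b c _ ab _ bc; exact: K0rel_trans ab bc.
- by move=> a a' b b' _ aa' _ bb'; exact: K0rel_add.
- by move=> a a' _ aa'; exact: K0rel_opp.
- by move=> a b c; exact: K0rel_addA.
- by move=> a b; exact: K0rel_addC.
- by move=> a; exact: K0rel_add0.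
- by move=> a; exact: K0rel_addN.
Qed.

Definition K0_res (u : K0 R G1) : K0 R G2 := K0class (K0term_res (K0repr u)).

Lemma K0_res_class a : K0_res (K0class a) = K0class (K0term_res a).
Proof. by apply/K0classP; apply: K0term_res_rel; exact: K0repr_class. Qed.

Lemma K0_res_gen P : K0_res (K0gen P) = K0gen (fgProj_res P).
Proof. exact: K0_res_class. Qed.

Lemma K0_resD u v : K0_res (K0add u v) = K0add (K0_res u) (K0_res v).
Proof.
by rewrite -(K0reprK u) -(K0reprK v) K0add_class !K0_res_class K0add_class.
Qed.

Lemma K0_resN u : K0_res (K0opp u) = K0opp (K0_res u).
Proof. by rewrite -(K0reprK u) K0opp_class !K0_res_class K0opp_class. Qed.

Lemma K0_res_altsum (P : nat -> fgProj R G1) (N : nat) :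
  K0_res (K0altsum P N) = K0altsum (fun n => fgProj_res (P n)) N.
Proof.
elim: N => [|N IHN]; first exact: K0_res_class.
rewrite !K0altsumS K0_resD IHN; congr K0add.
by case: (odd N); rewrite ?K0_resN K0_res_gen.
Qed.

Lemma finiteness_obstruction_res (o : K0 R G1) :
  is_finiteness_obstruction o -> is_finiteness_obstruction (K0_res o).
Proof.
move=> [P [N [Pproj [P0 ->]]]].
exists (res_resolution E P), N, (fun n => fg_proj_res (Pproj n)).
by split; [exact: vanishes_res|exact: K0_res_altsum].
Qed.

End RestrictionAdjoint.

Lemma res_res (R : pzRingType) (G1 G2 : smallCat) (E : catFun G2 G1) (F : catFun G1 G2)
    (M : catMod R G1) :
  nat_iso (compFun E F) (idFun G1) -> mod_iso (res_mod F (res_mod E M)) M.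
Proof.
move=> /nat_isoE [t [s [_ s_nat stK tsK]]].
pose f x : {linear res_mod F (res_mod E M) x -> M x} := mod_mor M (s x).
have f_nat x y (a : mor x y) m :
    f x (mod_mor (res_mod F (res_mod E M)) a m) = mod_mor M a (f y m).
  by rewrite /f /= -!mod_morM; have /= <- := s_nat _ _ a.
by apply: (pointwise_iso (f := ModHom f_nat) (g := fun x => mod_mor M (t x))) => x m;
  rewrite /= /f -mod_morM ?stK ?tsK mod_mor1.
Qed.

(** On generators this is [P o E o F = P] up to isomorphism. *)
Lemma K0_resK (R : pzRingType) (G1 G2 : smallCat) (E : catFun G2 G1) (F : catFun G1 G2)
    (A : adjunction E F) (B : adjunction F E) :
  nat_iso (compFun E F) (idFun G1) ->
  cancel (K0_res (R := R) A) (K0_res (R := R) B).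
Proof.
move=> EF u; rewrite -(K0reprK u); elim: (K0repr u) => [|P|a IHa b IHb|a IHa].
- by rewrite !K0_res_class.
- rewrite -[K0class _]/(K0gen P) !K0_res_gen; apply: K0gen_iso; exact: res_res.
- by rewrite -K0add_class !K0_resD IHa IHb.
- by rewrite -K0opp_class !K0_resN IHa.
Qed.

(** * Induction along a right adjoint *)

Section InductionAdjoint.
Variables (R : comPzRingType) (G1 G2 : smallCat).
Variables (E : catFun G2 G1) (F : catFun G1 G2) (A : adjunction E F).
Variable M : catMod R G1.

Section At.
Variable z : G2.

(** The evaluation [m (x) k |-> M(k') m], where [k' : E z -> x] corresponds to
    [k : z -> F x]. *)
Definition ind_ev x (m : M x) : {linear covrep R F z x -> M (E z)} :=
  lin_lift (@no_rel_lift R _ (M (E z))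
    (fun k : mor z (F x) => mod_mor M (adj_inv A k) m)).

Lemma ind_ev_gen x (m : M x) (k : mor z (F x)) :
  ind_ev m (fgen R k) = mod_mor M (adj_inv A k) m.
Proof. exact: plift_gen. Qed.

Lemma ind_evD x (m m' : M x) n : ind_ev (m + m') n = ind_ev m n + ind_ev m' n.
Proof.
elim/presented_ind: n => [|k|p q IHp IHq|s p IHp].
- by rewrite !linear0 addr0.
- by rewrite !ind_ev_gen linearD.
- by rewrite !linearD IHp IHq addrACA.
- by rewrite !linearZ IHp /= scalerDr.
Qed.

Lemma ind_evZ x r (m : M x) n : ind_ev (r *: m) n = r *: ind_ev m n.
Proof.
elim/presented_ind: n => [|k|p q IHp IHq|s p IHp].
- by rewrite !linear0.
- by rewrite !ind_ev_gen linearZ.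
- by rewrite !linearD IHp IHq.
- by rewrite linearZ IHp linearZ /= !scalerA mulrC.
Qed.

Lemma adj_inv_natr x y (f : mor x y) (k : mor z (F x)) :
  adj_inv A (fun_mor F f \c k) = f \c adj_inv A k.
Proof. by rewrite -[RHS](adj_trK A) adj_natr adj_invK. Qed.

Lemma ind_ev_mor x y (f : @mor G1 x y) (m : M y) n :
  ind_ev (mod_mor M f m) n =
  ind_ev m (@mod_mor R (opCat G1) (covrep R F z) y x f n).
Proof.
elim/presented_ind: n => [|k|p q IHp IHq|s p IHp].
- by rewrite !linear0.
- rewrite [X in ind_ev m X]free_map_gen !ind_ev_gen.
  by rewrite adj_inv_natr mod_morM.
- by rewrite !linearD IHp IHq.
- by rewrite !linearZ IHp.
Qed.

Let phi (s : tensor_symbol M (covrep R F z)) : M (E z) := ind_ev (ts_left s) (ts_right s).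

Lemma ind_ev_rel a b : tensor_rel a b -> peval phi a = peval phi b.
Proof.
case=> *; rewrite /= /phi /=.
- exact: ind_evD.
- exact: (linearD (ind_ev _)).
- exact: ind_evZ.
- exact: (linearZ_LR (ind_ev _)).
- exact: ind_ev_mor.
Qed.

Definition ind_to_res : {linear ind_mod F M z -> res_mod E M z} := lin_lift ind_ev_rel.

Lemma ind_to_res_tens x (m : M x) n :
  ind_to_res (tens m n) = ind_ev m n.
Proof. exact: (plift_gen ind_ev_rel). Qed.

(** Every tensor is moved to the object [E z], where its right factor becomes
    the unit [z -> F (E z)] of the adjunction. *)
Definition res_to_ind (m : res_mod E M z) : ind_mod F M z :=
  tens (m : M (E z)) (fgen R (adj_tr A (idm (E z))) : covrep R F z (E z)).

Lemma res_to_indK m : ind_to_res (res_to_ind m) = m.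
Proof. by rewrite ind_to_res_tens ind_ev_gen adj_trK mod_mor1. Qed.

(** The tensor relation for [adj_inv A k : E z -> x] turns the unit of the
    adjunction into [k]. *)
Lemma tens_adj x (m : M x) (k : mor z (F x)) :
  res_to_ind (mod_mor M (adj_inv A k) m) = tens m (fgen R k : covrep R F z x).
Proof.
rewrite /res_to_ind tens_mor; congr (tens _ _).
by rewrite [LHS]free_map_gen -adj_natr ccompm1 adj_invK.
Qed.

Lemma res_to_indD m m' : res_to_ind (m + m') = res_to_ind m + res_to_ind m'.
Proof. exact: tensDl. Qed.

Lemma res_to_indZ r m : res_to_ind (r *: m) = r *: res_to_ind m.
Proof. exact: tensZl. Qed.

Lemma res_to_ind0 : res_to_ind 0 = 0.
Proof. by rewrite -(scale0r 0) res_to_indZ scale0r. Qed.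

Lemma ind_to_resK p : res_to_ind (ind_to_res p) = p.
Proof.
elim/presented_ind: p => [|[x m n]|p q IHp IHq|r p IHp].
- by rewrite linear0 res_to_ind0.
- rewrite -[pgen _ _]/(tens m n) ind_to_res_tens.
  elim/presented_ind: n => [|k|p q IHp IHq|r p IHp].
  + by rewrite linear0 res_to_ind0 -[in RHS](scale0r 0) tensZr scale0r.
  + by rewrite ind_ev_gen tens_adj.
  + by rewrite linearD res_to_indD IHp IHq tensDr.
  + by rewrite linearZ res_to_indZ IHp tensZr.
- by rewrite linearD res_to_indD IHp IHq.
- by rewrite linearZ res_to_indZ IHp.
Qed.

End At.

Lemma adj_inv_natl w z x (g : mor w z) (k : mor z (F x)) :
  adj_inv A (k \c g) = adj_inv A k \c fun_mor E g.
Proof. by rewrite -[RHS](adj_trK A) adj_natl adj_invK. Qed.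

Lemma ind_to_res_nat w z (g : mor w z) p :
  ind_to_res w (mod_mor (ind_mod F M) g p) = mod_mor (res_mod E M) g (ind_to_res z p).
Proof.
elim/presented_ind: p => [|[x m n]|p q IHp IHq|r p IHp].
- by rewrite !linear0.
- rewrite -[pgen _ _]/(tens m n) [X in ind_to_res w X]tensor_map_tens.
  rewrite !ind_to_res_tens.
  elim/presented_ind: n => [|k|p q IHp IHq|r p IHp].
  + by rewrite !linear0.
  + rewrite [X in ind_ev w m X]free_map_gen !ind_ev_gen.
    by rewrite adj_inv_natl mod_morM.
  + by rewrite !linearD IHp IHq.
  + by rewrite !linearZ IHp.
- by rewrite !linearD IHp IHq.
- by rewrite !linearZ IHp.
Qed.

Lemma ind_res_iso : mod_iso (ind_mod F M) (res_mod E M).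
Proof.
exact: (pointwise_iso (f := ModHom ind_to_res_nat) (g := res_to_ind)
  ind_to_resK res_to_indK).
Qed.

End InductionAdjoint.

Lemma K0_res_induced (R : comPzRingType) (G1 G2 : smallCat)
    (E : catFun G2 G1) (F : catFun G1 G2) (A : adjunction E F) :
  K0_induced F (K0_res (R := R) A).
Proof.
split=> [u v|P]; first exact: K0_resD.
have indP := fg_proj_iso (ind_res_iso A P) (fgpP (fgProj_res A P)).
exists indP; rewrite K0_res_gen; apply: K0gen_iso.
exact/mod_iso_sym/ind_res_iso.
Qed.

(** * Equivalent categories have the same finiteness properties *)

Theorem theorem2p8 (R : comPzRingType) (G1 G2 : smallCat) (F : catFun G1 G2)
    (hF : is_equivalence F) :
  [/\ type_FP R G1 <-> type_FP R G2,
      exists Fstar : K0 R G1 -> K0 R G2,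
        [/\ K0_induced F Fstar,
            bijective Fstar
          & type_FP R G1 ->
            forall (o1 : K0 R G1) (o2 : K0 R G2),
              is_finiteness_obstruction o1 -> is_finiteness_obstruction o2 ->
              Fstar o1 = o2]
    & type_FF R G1 <-> type_FF R G2].
Proof.
have [E [EF FE]] := hF.
have [A] := equivalence_adjunction EF FE; have [B] := equivalence_adjunction FE EF.
split; [by split; [exact: type_FP_res A|exact: type_FP_res B]| |
        by split; [exact: type_FF_res A|exact: type_FF_res B]].
exists (K0_res A); split; first exact: K0_res_induced.
  by exists (K0_res B); exact: K0_resK.
move=> _ o1 o2 /(finiteness_obstruction_res A) o1E o2E.
exact: finiteness_obstruction_unique o1E o2E.
Qed.
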